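(* Let $C(q)$ be a formal power series with $C(0)=1$, let $c_j:=[q^j]\frac{1}{C(q)}$ for $j\ge0$ and $c_j:=0$ for $j<0$, and let $\gamma:\mathbb{Z}^{+}\to\mathbb{C}$ be a function with $\gamma(1)\ne0$. Define $s^{(-1)}_{n,k}(\gamma):=\sum_{d\mid n}c_{d-k}\,\gamma(n/d)$ for $n,k\ge1$ (a lower-triangular array with diagonal entries $\gamma(1)$), and let $s_{n,k}=s_{n,k}(\gamma)$ be the entries of its inverse lower-triangular matrix (so $s_{n,k}=0$ for $k>n$). Let $\{a_n\}_{n\ge1}$ be an arbitrary sequence and let $\{\widetilde{a}'_n\}_{n\ge1}$ be a sequence such that, as formal power series in $q$, \[ \sum_{n\ge1}\frac{\widetilde{a}'_n q^n}{1-q^n}=\frac{1}{C(q)}\sum_{n\ge1}\sum_{k=1}^{n}s_{n,k}(\gamma)\,a_k\,q^n . \] Then for all $m\ge1$, \[ \sum_{d\mid m}\widetilde{a}'_d=\sum_{i=1}^{m}\sum_{j=1}^{m+1-i}a_i\,s_{m+1-j,i}\,[q^{j-1}]\frac{1}{C(q)} . \]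
   Context: $[q^j]F(q)$ denotes the coefficient of $q^j$ in a formal power series $F(q)$. *)

(* Defs.v *)
From mathcomp Require Import all_boot all_order all_algebra.
From mathcomp Require Import complex.
From mathcomp Require Import reals.

Set Implicit Arguments.
Unset Strict Implicit.
Unset Printing Implicit Defensive.

Import Order.TTheory GRing.Theory Num.Theory.

Local Open Scope ring_scope.

(* A formal power series is its coefficient function: [q^j]F(q) is [F j]. *)
Definition fps (K : fieldType) := nat -> K.

Definition fps_mul (K : fieldType) (F G : fps K) : fps K :=
  fun n => \sum_(i < n.+1) F i * G (n - i)%N.

Definition poly_fps (K : fieldType) (p : {poly K}) : fps K := fun n => p`_n.

(* The first n coefficients of 1/F, from the recurrence
   F_0 g_m = - (F_m g_0 + ... + F_1 g_(m-1)); see fps_mulV below. *)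
Fixpoint fps_inv_seq (K : fieldType) (F : fps K) (n : nat) : seq K :=
  if n is m.+1 then
    let g := fps_inv_seq F m in
    rcons g ((F 0%N)^-1 * ((m == 0%N)%:R - \sum_(i < m) F (m - i)%N * g`_i))
  else [::].

Definition fps_inv (K : fieldType) (F : fps K) : fps K :=
  fun n => (fps_inv_seq F n.+1)`_n.

(* The series \sum_(n >= 1) F_n converges to S in the formal (q-adic) sense:
   every coefficient of the partial sums is eventually that of S. *)
Definition fps_has_sum1 (K : fieldType) (F : nat -> fps K) (S : fps K) : Prop :=
  forall j : nat, exists N0 : nat, forall N : nat, (N0 <= N)%N ->
    \sum_(1 <= n < N) F n j = S j.

Definition ogf1 (K : fieldType) (u : nat -> K) : fps K :=
  fun n => if n == 0%N then 0 else u n.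

Definition lambert_term (K : fieldType) (u : nat -> K) (n : nat) : fps K :=
  fps_mul (poly_fps (u n *: 'X^n)) (fps_inv (poly_fps (1 - 'X^n))).

Definition inv_coef (K : fieldType) (C : fps K) (j : int) : K :=
  match j with Posz n => fps_inv C n | Negz _ => 0 end.

(* Functions on the positive integers, and arrays indexed by them, are given on
   nat; their values at 0 are irrelevant. *)
Definition sinv (K : fieldType) (C : fps K) (gamma : nat -> K) (n k : nat) : K :=
  \sum_(d <- divisors n) inv_coef C (d%:Z - k%:Z) * gamma (n %/ d)%N.

Definition lower_triangular (K : fieldType) (A : nat -> nat -> K) : Prop :=
  forall n k : nat, (0 < n)%N -> (n < k)%N -> A n k = 0.

(* Product of infinite arrays indexed by n, k >= 1; truncating the sum at n is
   legitimate because the left factor is lower triangular. *)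
Definition ltri_mul (K : fieldType) (A B : nat -> nat -> K) (n k : nat) : K :=
  \sum_(1 <= j < n.+1) A n j * B j k.

Definition ltri_inverse (K : fieldType) (A B : nat -> nat -> K) : Prop :=
  [/\ lower_triangular B,
      forall n k : nat, (0 < n)%N -> (0 < k)%N -> ltri_mul A B n k = (n == k)%:R
    & forall n k : nat, (0 < n)%N -> (0 < k)%N -> ltri_mul B A n k = (n == k)%:R].

Lemma size_fps_inv_seq (K : fieldType) (F : fps K) n :
  size (fps_inv_seq F n) = n.
Proof. by elim: n => //= n IH; rewrite size_rcons IH. Qed.

Lemma nth_fps_inv_seq (K : fieldType) (F : fps K) n i :
  (i < n)%N -> (fps_inv_seq F n)`_i = fps_inv F i.
Proof.
elim: n => // n IH; rewrite ltnS leq_eqVlt => /orP[/eqP->//|lt_in].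
by rewrite /= nth_rcons size_fps_inv_seq lt_in IH.
Qed.

Lemma fps_mulV (K : fieldType) (F : fps K) :
  F 0%N != 0 -> fps_mul F (fps_inv F) =1 poly_fps 1.
Proof.
move=> F0 n; rewrite /poly_fps coef1 /fps_mul.
rewrite (reindex_inj rev_ord_inj) big_ord_recr /= subSS subnn.
rewrite [X in F 0%N * fps_inv F X](_ : _ = n) ?subn0 //.
have -> : fps_inv F n = (F 0%N)^-1 *
    ((n == 0%N)%:R - \sum_(i < n) F (n - i)%N * fps_inv F i).
  rewrite {1}/fps_inv /= nth_rcons size_fps_inv_seq ltnn eqxx.
  by congr (_ * (_ - _)); apply: eq_bigr => i _; rewrite nth_fps_inv_seq.
rewrite mulrA mulfV // mul1r.
under eq_bigr => i _ do rewrite subSS subKn ?(ltnW (ltn_ord i)) //.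
by rewrite addrC subrK.
Qed.

Lemma sinv_lower (K : fieldType) (C : fps K) (gamma : nat -> K) :
  lower_triangular (sinv C gamma).
Proof.
move=> n k n0 nk; rewrite /sinv big_seq big1 // => d; rewrite -dvdn_divisors // => dn.
have dk : (d < k)%N by apply: leq_ltn_trans nk; apply: dvdn_leq.
have -> : d%:Z - k%:Z = Negz (k - d).-1.
  by rewrite NegzE prednK ?subn_gt0 // -subzn ?opprB // ltnW.
by rewrite mul0r.
Qed.

(* Main.v *)
(* For [m > 0] the coefficient of [q^m] in [u_n q^n / (1 - q^n)] is [u_n] if
   [n | m] and [0] otherwise, so the Lambert series has [q^m]-coefficient
   [\sum_(d | m) a' d]; compare it with the Cauchy product on the right-hand side
   and exchange the order of summation over [i + j <= m + 1]. *)
Require Import Defs.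
From mathcomp Require Import all_boot all_order all_algebra.
From mathcomp Require Import complex.
From mathcomp Require Import reals.
From mathcomp Require Import zify.

Set Implicit Arguments.
Unset Strict Implicit.
Unset Printing Implicit Defensive.

Import Order.TTheory GRing.Theory Num.Theory.

Local Open Scope ring_scope.

Lemma fps_mul_monomial (K : fieldType) (c : K) (n : nat) (G : fps K) (j : nat) :
  fps_mul (poly_fps (c *: 'X^n)) G j = if (n <= j)%N then c * G (j - n)%N else 0.
Proof.
rewrite /fps_mul /poly_fps; case: leqP => le_nj; last first.
  apply: big1 => i _; rewrite coefZ coefXn ltn_eqF ?mulr0 ?mul0r //.
  exact: leq_trans (ltn_ord i) _.
rewrite (bigD1 (Ordinal (le_nj : (n < j.+1)%N))) //= coefZ coefXn eqxx mulr1.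
rewrite big1 ?addr0 // => i /negPf ne_in.
by rewrite coefZ coefXn (ne_in : (i == n :> nat) = false) mulr0 mul0r.
Qed.

(** Geometric series: comparing coefficients in [(1 - 'X^n) * G = 1] gives [G k = [k = 0] + G (k -
    n)], which by strong induction leaves a 1 exactly at the multiples of [n]. *)
Lemma fps_inv_1subXn (K : fieldType) (n j : nat) :
  (0 < n)%N -> fps_inv (poly_fps (1 - 'X^n : {poly K})) j = (n %| j)%:R.
Proof.
move=> n_gt0; set G := fps_inv _.
have G_rec k : G k = (k == 0%N)%:R + (if (n <= k)%N then G (k - n)%N else 0).
  have F0 : poly_fps (1 - 'X^n : {poly K}) 0%N != 0.
    by rewrite /poly_fps coefB coef1 coefXn eqxx (ltn_eqF n_gt0) subr0 oner_eq0.
  have := fps_mulV F0 k; rewrite [RHS]/poly_fps coef1 => <-.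
  (* Writing [1] as [1 *: 'X^0] lets [fps_mul_monomial] evaluate both products. *)
  have -> : fps_mul (poly_fps (1 - 'X^n)) G k
      = fps_mul (poly_fps (1 *: 'X^0)) G k - fps_mul (poly_fps (1 *: 'X^n)) G k.
    rewrite /fps_mul -sumrB; apply: eq_bigr => i _.
    by rewrite /poly_fps !scale1r expr0 coefB mulrBl.
  rewrite !fps_mul_monomial leq0n !mul1r subn0.
  by rewrite subrK.
elim/ltn_ind: j => j IHj; rewrite G_rec; case: leqP => [le_nj | lt_jn].
  rewrite IHj ?ltn_subrL ?n_gt0 ?(leq_trans n_gt0) //.
  by rewrite dvdn_subl // gtn_eqF ?(leq_trans n_gt0) // add0r.
rewrite addr0; case: j lt_jn {IHj} => [|j] lt_jn; first by rewrite dvdn0.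
by rewrite gtnNdvd.
Qed.

Lemma lambert_termE (K : fieldType) (u : nat -> K) (n m : nat) :
  (0 < n)%N -> (0 < m)%N -> lambert_term u n m = if (n %| m)%N then u n else 0.
Proof.
move=> n_gt0 m_gt0; rewrite /lambert_term fps_mul_monomial fps_inv_1subXn //.
case: leqP => [le_nm | lt_mn]; last by rewrite gtnNdvd.
by rewrite dvdn_subl //; case: ifP; rewrite ?mulr1 ?mulr0.
Qed.

(** Only divisors of [m] contribute, and all of them are at most [m < N], so the partial sum has
    already stabilised. *)
Lemma sum_lambert_term (K : fieldType) (u : nat -> K) (N m : nat) :
  (0 < m)%N -> (m < N)%N ->
  \sum_(1 <= n < N) lambert_term u n m = \sum_(d <- divisors m) u d.
Proof.
move=> m_gt0 lt_mN.
rewrite (eq_big_nat _ _ (F2 := fun n => if (n %| m)%N then u n else 0)); last first.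
  by move=> n /andP[n_gt0 _]; apply: lambert_termE.
rewrite -big_mkcond -big_filter; apply: perm_big; apply: uniq_perm.
- by rewrite filter_uniq ?iota_uniq.
- exact: divisors_uniq.
move=> d; rewrite mem_filter mem_index_iota -dvdn_divisors //.
case: (boolP (d %| m)%N) => //= dvd_dm.
by rewrite (dvdn_gt0 m_gt0) // (leq_ltn_trans (dvdn_leq m_gt0 dvd_dm)).
Qed.

(** The last Cauchy term vanishes because [ogf1 u] has no constant term; the others are reindexed
    from 1. *)
Lemma fps_mul_ogf1 (K : fieldType) (F : fps K) (u : nat -> K) (m : nat) :
  fps_mul F (ogf1 u) m = \sum_(1 <= j < m.+1) F (j - 1)%N * u (m + 1 - j)%N.
Proof.
rewrite /fps_mul big_ord_recr /= subnn /ogf1 eqxx mulr0 addr0.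
rewrite big_add1 /= big_mkord; apply: eq_bigr => i _.
by rewrite subn1 addn1 subSS /= gtn_eqF ?subn_gt0.
Qed.

Theorem theorem4 (R : realType) (C : fps R[i]) (gamma : nat -> R[i])
    (s : nat -> nat -> R[i]) (a a' : nat -> R[i])
    (hC : C 0%N = 1)
    (hgamma : gamma 1%N != 0)
    (hs : ltri_inverse (sinv C gamma) s)
    (ha' : fps_has_sum1 (lambert_term a')
             (fps_mul (fps_inv C)
                (ogf1 (fun n => \sum_(1 <= k < n.+1) s n k * a k)))) :
  forall m : nat, (0 < m)%N ->
    \sum_(d <- divisors m) a' d
    = \sum_(1 <= i < m.+1) \sum_(1 <= j < (m + 1 - i).+1)
        a i * s (m + 1 - j)%N i * fps_inv C (j - 1)%N.
Proof.
move=> m m_gt0.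
have [N0 lambertE] := ha' m.
(* This cutoff lies past both the convergence threshold [N0] and every divisor of [m]. *)
rewrite -(@sum_lambert_term _ _ (maxn N0 m.+1)) ?leq_maxr //.
rewrite lambertE ?leq_maxl // fps_mul_ogf1.
(* The inner range depends on [j]; widening it to a fixed one turns the bound into a side condition,
   so the sums can be exchanged. *)
under eq_big_nat => j ? do [rewrite mulr_sumr (big_nat_widen _ _ m.+1); last by lia].
rewrite (exchange_big_dep_nat xpredT) //=.
apply: eq_big_nat => i ?; rewrite [RHS](big_nat_widen _ _ m.+1); last by lia.
(* Within the ranges, both side conditions say [i + j <= m + 1]. *)
rewrite big_nat_cond [RHS]big_nat_cond; apply: eq_big => [j | j _]; first by lia.
by rewrite mulrC [s _ _ * _]mulrC.
Qed.
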